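(* Let $n$ be a positive integer and let $0\le k\le n$. Let $E_{n,k}$ denote the set of decorated permutations on $[n]$ with exactly $k$ signed fixed points. Then $$\sum_{\pi\in E_{n,k}} q^{\operatorname{maj}(\pi)} = q^{\binom{k}{2}}\,\frac{[n]_q!}{[k]_q!}.$$
   Context: Write $[n]=\{1,2,\ldots,n\}$. A decorated permutation on $[n]$ is a permutation $\pi=\pi_1\cdots\pi_n$ of $[n]$ in which each fixed point (an $i$ with $\pi_i=i$) is either left unsigned or assigned a minus sign; a signed fixed point $i$ is written $\overline{i}$. Thus a decorated permutation is a word $\pi_1\cdots\pi_n$ in which the letter at position $i$ may be $\overline{i}$ instead of $i$ when $i$ is a fixed point. Nonfixed points are never signed. Decorated permutations are regarded as words in the totally ordered alphabet $\overline{n}<\cdots<\overline{2}<\overline{1}<1<2<\cdots<n$. With respect to this order, $\operatorname{Des}(\pi)=\{i : 1\le i\le n-1,\ \pi_i>\pi_{i+1}\}$ and $\operatorname{maj}(\pi)=\sum_{i\in\operatorname{Des}(\pi)} i$. For a positive integer $m$, $[m]_q=1+q+\cdots+q^{m-1}$ and $[m]_q!=[1]_q[2]_q\cdots[m]_q$, with $[0]_q!=1$. *)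

(* Defs.v *)
From HB Require Import structures.
From mathcomp Require Import all_boot all_order all_fingroup all_algebra.

Set Implicit Arguments.
Unset Strict Implicit.
Unset Printing Implicit Defensive.

Import Order.TTheory GRing.Theory Num.Theory.

Local Open Scope ring_scope.

(* Positions and values are the ordinals 0, ..., n-1; the ordinal i stands for
   the integer i + 1 of {1, ..., n}. *)
Record decperm (n : nat) := DecPerm {
  dp_pair : 'S_n * {set 'I_n};
  _ : dp_pair.2 \subset [set i | dp_pair.1 i == i] }.

HB.instance Definition _ (n : nat) := [isSub for @dp_pair n].
HB.instance Definition _ (n : nat) := [Finite of decperm n by <:].

Definition dp_perm (n : nat) (p : decperm n) : 'S_n := (dp_pair p).1.
Definition dp_signed (n : nat) (p : decperm n) : {set 'I_n} := (dp_pair p).2.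

(* The letter m is the integer m and the signed letter \bar m is the integer -m,
   so that \bar n < ... < \bar 1 < 1 < ... < n is the usual order of int. *)
Definition dp_letter (n : nat) (p : decperm n) (i : 'I_n) : int :=
  if i \in dp_signed p then - (dp_perm p i).+1%:Z else (dp_perm p i).+1%:Z.

Definition dp_word (n : nat) (p : decperm n) : seq int :=
  [seq dp_letter p i | i <- enum 'I_n].

(* Descents are 1-based: the letter at position i of w is w`_(i.-1). *)
Definition Des (w : seq int) : seq nat :=
  [seq i <- iota 1 (size w).-1 | w`_i < w`_(i.-1)].

Definition maj (w : seq int) : nat := (\sum_(i <- Des w) i)%N.

Definition signed_decperms (n k : nat) : {set decperm n} :=
  [set p | #|dp_signed p| == k].

Definition qint (R : nzRingType) (q : R) (m : nat) : R :=
  \sum_(0 <= i < m) q ^+ i.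

Definition qfact (R : nzRingType) (q : R) (m : nat) : R :=
  \prod_(1 <= i < m.+1) qint q i.

(* The indeterminate q, in the field of rational functions over the integers,
   where the quotient of q-factorials is a genuine quotient. *)
Definition qvar : {fraction {poly int}} := tofrac ('X : {poly int}).

(* Main.v *)
Require Import Defs.
From HB Require Import structures.
From mathcomp Require Import all_boot all_order all_fingroup all_algebra.
From mathcomp Require Import zify ring.

Set Implicit Arguments.
Unset Strict Implicit.
Unset Printing Implicit Defensive.

Import Order.TTheory GRing.Theory Num.Theory.

Local Open Scope ring_scope.

(** The signed letters of a decorated permutation decrease from left to right,
    because a signed letter is determined by its position, and they are smaller
    than all the unsigned ones.  Since maj depends only on the relative order of
    the letters, p in E_{n,k} may be replaced by its standardization: the signed
    fixed points become -1, ..., -k from left to right, and the unsigned letters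
    are renumbered 1, ..., n-k in increasing order.  The result is a shuffle of
    the word -1 -2 ... -k with a permutation of 1, ..., n-k, and every such shuffle
    arises exactly once: the places of the negative letters are the signed fixed
    points, and they leave the permutation induced on the other places
    unconstrained ([std_word_inj], [std_word_shuffle], [card_signed_decperms]).

    These shuffles are easy to count by maj, because they are produced from
    -1 ... -k by inserting 1, 2, ..., n-k in turn, each at an arbitrary place.
    The letter inserted is larger than all the others, and inserting a maximal
    letter in the N + 1 places of a word of length N increases maj by each of
    0, ..., N exactly once ([sum_maj_insert]), whence a factor [N + 1]_q.
    The initial word has maj equal to 0 + 1 + ... + (k-1) = 'C(k, 2), and N runs
    from k to n-1: the sum is q^'C(k, 2) [k+1]_q ... [n]_q
    ([sum_maj_shuffles]). *)

(** * The major index of a word *)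

Lemma majE (w : seq int) :
  maj w = (\sum_(0 <= i < (size w).-1) (if (w`_i.+1 < w`_i)%R then i.+1 else 0))%N.
Proof.
by rewrite /maj /Des big_filter big_mkcond /= -[1%N]addn0 iotaDl big_map /index_iota subn0.
Qed.

(** Reading a word from left to right makes inductions on maj possible; with [y]
    as the default, [last y u] gives no descent when [u] is empty. *)
Lemma maj_rcons (u : seq int) (y : int) :
  maj (rcons u y) = (maj u + if (y < last y u)%R then size u else 0)%N.
Proof.
case: u => [|a u]; first by rewrite !majE !big_geq //= ltxx.
rewrite !majE size_rcons /= big_nat_recr //=; congr (_ + _)%N.
- apply: eq_big_nat => i /andP[_ lt_iu].
  by rewrite -!rcons_cons !nth_rcons /= lt_iu leqW.
- by rewrite -!rcons_cons !nth_rcons /= ltnn eqxx ltnSn -last_nth.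
Qed.

Lemma maj_map_eq (T : eqType) (f g : T -> int) (s : seq T) :
  {in s &, forall x y, (f x < f y) = (g x < g y)} ->
  maj (map f s) = maj (map g s).
Proof.
elim/last_ind: s => // s y IHs fg; rewrite !map_rcons !maj_rcons !size_map.
rewrite IHs => [|x z xs zs]; last by rewrite fg ?mem_rcons ?inE ?xs ?zs ?orbT.
case: s {IHs} fg => [|a s] fg /=; first by rewrite !ltxx.
by rewrite !last_map fg // mem_rcons inE ?eqxx ?mem_last ?orbT.
Qed.

Lemma qint_recr (R : nzRingType) (q : R) (m : nat) :
  qint q m.+1 = qint q m + q ^+ m.
Proof. by rewrite /qint big_nat_recr. Qed.

Lemma qintS (R : nzRingType) (q : R) (m : nat) :
  qint q m.+1 = 1 + q * qint q m.
Proof.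
rewrite /qint big_nat_recl // expr0 big_distrr /=.
by congr (_ + _); apply: eq_bigr => i _; rewrite exprS.
Qed.

Definition insert_at (T : Type) (x : T) (w : seq T) (j : nat) : seq T :=
  take j w ++ x :: drop j w.

Lemma size_insert_at (T : Type) (x : T) (w : seq T) (j : nat) :
  size (insert_at x w j) = (size w).+1.
Proof. by rewrite size_cat /= addnS -size_cat cat_take_drop. Qed.

Lemma last_insert_at (T : Type) (y x : T) (w : seq T) (j : nat) :
  (j < size w)%N -> last y (insert_at x w j) = last y w.
Proof.
move=> lt_jw; rewrite last_cat /= -[in RHS](cat_take_drop j w) last_cat.
by rewrite (drop_nth x lt_jw).
Qed.

Lemma insert_at_size (T : Type) (x : T) (w : seq T) :
  insert_at x w (size w) = rcons w x.
Proof. by rewrite /insert_at take_size drop_size cats1. Qed.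

Lemma insert_at_rcons (T : Type) (x y : T) (w : seq T) (j : nat) :
  (j <= size w)%N -> insert_at x (rcons w y) j = rcons (insert_at x w j) y.
Proof.
move=> le_jw; rewrite /insert_at -!cats1 takel_cat // drop_cat -catA.
by case: ltngtP le_jw => // -> _; rewrite subnn drop0 drop_size.
Qed.

Lemma maj_rcons_max (x : int) (w : seq int) :
  all (fun y => y < x) w -> maj (rcons w x) = maj w.
Proof.
rewrite maj_rcons; case: (lastP w) => [|v z]; first by rewrite ltxx addn0.
by rewrite all_rcons last_rcons => /andP[/ltW/le_gtF-> _]; rewrite addn0.
Qed.

(** By induction on the last letter [y] of the word [rcons u y], of length N + 1.
    Putting [x] last changes nothing; putting it just before [y] turns the
    possible descent at N into one at N + 1; putting it anywhere else commutes
    with appending [y] to [u], and only moves the possible descent at N to N + 1.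
    Whether or not there is such a descent, the resulting increments are
    0, ..., N + 1, in an order that depends on the case. *)
Lemma sum_maj_insert (R : comNzRingType) (q : R) (x : int) (w : seq int) :
  all (fun y => y < x) w ->
  \sum_(0 <= j < (size w).+1) q ^+ maj (insert_at x w j) =
  qint q (size w).+1 * q ^+ maj w.
Proof.
elim/last_ind: w => [_|u y IHu lt_uyx].
  by rewrite /qint !big_nat1 /insert_at /= !majE !big_geq // mulr1.
have := lt_uyx; rewrite all_rcons => /andP[lt_yx lt_ux].
have := IHu lt_ux.
rewrite big_nat_recr //= insert_at_size maj_rcons_max // => {}IHu.
rewrite size_rcons !big_nat_recr //= -[in insert_at x _ _.+1](size_rcons u y) insert_at_size.
rewrite maj_rcons_max // insert_at_rcons // insert_at_size.
set d := if y < last y u then (size u).+1 else 0%N.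
have sum_inner :
    \sum_(0 <= j < size u) q ^+ maj (insert_at x (rcons u y) j) =
    q ^+ d * \sum_(0 <= j < size u) q ^+ maj (insert_at x u j).
  rewrite big_distrr /=; apply: eq_big_nat => j /andP[_ lt_ju].
  rewrite insert_at_rcons ?(ltnW lt_ju) // maj_rcons size_insert_at.
  by rewrite last_insert_at // exprD mulrC.
rewrite sum_inner.
rewrite (maj_rcons (rcons u x)) (maj_rcons u y) last_rcons lt_yx maj_rcons_max //.
rewrite size_rcons.
(* All the places of [u] but its end: the increments 1, ..., size u. *)
have {sum_inner}sumE :
    \sum_(0 <= j < size u) q ^+ maj (insert_at x u j) =
    q * qint q (size u) * q ^+ maj u.
  by apply: (addIr (q ^+ maj u)); rewrite IHu qintS; ring.
rewrite sumE /d; case: ifP => _.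
  by rewrite 2!qintS !exprD exprS; ring.
by rewrite addn0 expr0 qint_recr qintS exprD; ring.
Qed.


(** * Shuffles of a decreasing negative word with a permutation *)

Definition neg_word (k : nat) : seq int := [seq - i.+1%:Z | i <- iota 0 k].

(** The shuffles of [neg_word k] with the permutations of 1, ..., m, listed by
    the insertion of 1, ..., m in turn, so that [sum_maj_insert] applies at each
    step; [mem_shuffles] shows that no shuffle is missed. *)
Fixpoint shuffles (m k : nat) : seq (seq int) :=
  if m is m'.+1 then
    [seq insert_at m'.+1%:Z w j | w <- shuffles m' k, j <- index_iota 0 (m' + k).+1]
  else [:: neg_word k].

(* Unfolding by computation would also expand the interval of places. *)
Lemma shufflesS (m k : nat) :
  shuffles m.+1 k =
  [seq insert_at m.+1%:Z w j | w <- shuffles m k, j <- index_iota 0 (m + k).+1].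
Proof. by []. Qed.

Lemma iota_rcons (k : nat) : iota 0 k.+1 = rcons (iota 0 k) k.
Proof. by rewrite -addn1 iotaD cats1. Qed.

Lemma maj_neg_word (k : nat) : maj (neg_word k) = 'C(k, 2).
Proof.
elim: k => [|k IHk]; first by rewrite majE big_geq.
rewrite /neg_word iota_rcons map_rcons maj_rcons IHk size_map size_iota.
rewrite binS bin1; congr (_ + _)%N.
case: k {IHk} => [|k]; first by rewrite ltxx.
by rewrite iota_rcons map_rcons last_rcons ltrN2 ltz_nat ltnSn.
Qed.

Lemma shuffles_size_bound (m k : nat) (w : seq int) :
  w \in shuffles m k -> (size w == m + k)%N && all (fun x => x < m.+1%:Z) w.
Proof.
elim: m w => [|m IHm] w.
  rewrite inE => /eqP->; rewrite size_map size_iota eqxx.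
  by apply/allP => _ /mapP[i _ ->]; lia.
rewrite shufflesS => /allpairsP[[v j] /= [/IHm/andP[/eqP size_v lt_v] _ ->]].
rewrite size_insert_at size_v addSn eqxx -[v](cat_take_drop j) all_cat in lt_v *.
rewrite /insert_at !cat_take_drop all_cat /=.
have lt_m x : x < m.+1%:Z -> x < m.+2%:Z by lia.
by case/andP: lt_v => /(sub_all lt_m)-> /(sub_all lt_m)->; rewrite ltz_nat ltnSn.
Qed.

Lemma sum_maj_shuffles (R : comNzRingType) (q : R) (m k : nat) :
  \sum_(w <- shuffles m k) q ^+ maj w =
  q ^+ 'C(k, 2) * \prod_(k.+1 <= i < (m + k).+1) qint q i.
Proof.
elim: m => [|m IHm].
  by rewrite big_seq1 maj_neg_word big_geq // mulr1.
rewrite shufflesS big_allpairs_dep /= big_seq.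
under eq_bigr => w /shuffles_size_bound/andP[/eqP size_w lt_w].
  rewrite -size_w sum_maj_insert // size_w.
  over.
rewrite -big_seq -big_distrr /= IHm addSn [in RHS]big_nat_recr ?ltnS ?leq_addl //=.
by rewrite mulrC mulrA.
Qed.

Lemma size_shuffles (m k : nat) : (size (shuffles m k) * k`! = (m + k)`!)%N.
Proof.
elim: m => [|m IHm]; first by rewrite mul1n.
by rewrite shufflesS size_allpairs size_iota mulnAC IHm mulnC addSn factS.
Qed.

(** Deleting the largest letter undoes the last insertion. *)
Lemma mem_shuffles (m k : nat) (w : seq int) :
  [seq x <- w | x < 0] = neg_word k ->
  perm_eq [seq x <- w | 0 <= x] [seq i.+1%:Z | i <- iota 0 m] ->
  w \in shuffles m k.
Proof.
elim: m w => [|m IHm] w neg_w pos_w.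
  rewrite inE -neg_w eq_sym; apply/eqP/all_filterP/allP => x w_x.
  by have := perm_mem pos_w x; rewrite mem_filter w_x andbT leNgt => /negbFE.
have : m.+1%:Z \in [seq x <- w | 0 <= x].
  by rewrite (perm_mem pos_w) (map_f (fun i => i.+1%:Z)) // mem_iota add0n /=.
rewrite mem_filter => /andP[_].
move=> /splitPr w_split; case: w_split neg_w pos_w => u v neg_w pos_w.
have uv_shuffle : u ++ v \in shuffles m k.
  apply: IHm; first by move: neg_w; rewrite !filter_cat.
  move: pos_w; rewrite !filter_cat iota_rcons map_rcons /= => pos_w.
  rewrite -(perm_cons m.+1%:Z) -cat1s perm_catCA (perm_trans pos_w) //.
  by rewrite perm_rcons.
have /andP[/eqP size_uv _] := shuffles_size_bound uv_shuffle.
rewrite shufflesS; apply/allpairsP; exists (u ++ v, size u) => /=.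
rewrite /insert_at take_size_cat // drop_size_cat //; split=> //.
by rewrite mem_index_iota -size_uv size_cat ltnS leq_addr.
Qed.

(** * Standardization of decorated permutations *)

(** Ranks are positions in the increasing enumeration of the signed fixed points,
    respectively of their complement; the latter contains the values of the
    unsigned letters as well as their places, since [dp_perm p] preserves it. *)
Definition std_letter (n : nat) (p : decperm n) (i : 'I_n) : int :=
  if i \in dp_signed p then - (index i (enum (dp_signed p))).+1%:Z
  else (index (dp_perm p i) (enum (~: dp_signed p))).+1%:Z.

Definition std_word (n : nat) (p : decperm n) : seq int :=
  [seq std_letter p i | i <- enum 'I_n].

Lemma decperm_eq (n : nat) (p p' : decperm n) :
  dp_perm p = dp_perm p' -> dp_signed p = dp_signed p' -> p = p'.
Proof.
move=> eq_perm eq_signed; apply: val_inj; move: eq_perm eq_signed.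
by rewrite /dp_perm /dp_signed /=; case: (dp_pair p) (dp_pair p') => ? ? [? ?] /= -> ->.
Qed.

Lemma dp_signed_fix (n : nat) (p : decperm n) (i : 'I_n) :
  i \in dp_signed p -> dp_perm p i = i.
Proof.
by rewrite /dp_signed /dp_perm; case: p => [[s S] /= /subsetP fixS] /fixS;
   rewrite inE => /eqP.
Qed.

Lemma dp_perm_signed (n : nat) (p : decperm n) (i : 'I_n) :
  (dp_perm p i \in dp_signed p) = (i \in dp_signed p).
Proof.
apply/idP/idP => [Spi|Si]; last by rewrite dp_signed_fix.
by rewrite -(perm_inj (dp_signed_fix Spi)).
Qed.

Lemma ltn_index_enum (n : nat) (A : {set 'I_n}) (i j : 'I_n) :
  i \in A -> j \in A -> (index i (enum A) < index j (enum A))%N = (i < j)%N.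
Proof.
move=> Ai Aj; have sortedA : sorted (fun i j : 'I_n => i < j)%N (enum A).
  have -> : enum A = [seq i <- enum 'I_n | i \in A] by rewrite enumT.
  apply: sorted_filter => [x y z|]; first exact: ltn_trans.
  by have := iota_ltn_sorted 0 n; rewrite -val_enum_ord sorted_map.
have index_lt (x y : 'I_n) : x \in A -> y \in A ->
    (index x (enum A) < index y (enum A))%N -> (x < y)%N.
  move=> Ax Ay; apply: (sorted_ltn_index _ sortedA); rewrite ?mem_enum //.
  by move=> a b c; apply: ltn_trans.
case: (ltngtP (index i _)) => [lt_ij|lt_ji|eq_ij].
- by rewrite index_lt.
- by rewrite ltnNge ltnW // index_lt.
- by rewrite (index_inj i _ _ eq_ij) ?mem_enum // ltnn.
Qed.

Lemma std_letter_lt (n : nat) (p : decperm n) (i j : 'I_n) :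
  (std_letter p i < std_letter p j) = (dp_letter p i < dp_letter p j).
Proof.
rewrite /std_letter /dp_letter.
case: ifP => Si; case: ifP => Sj; try by apply/idP/idP; lia.
  by rewrite !ltrN2 !ltz_nat !ltnS ltn_index_enum // !dp_signed_fix.
by rewrite !ltz_nat !ltnS ltn_index_enum // inE dp_perm_signed ?Si ?Sj.
Qed.

Lemma maj_std_word (n : nat) (p : decperm n) :
  maj (std_word p) = maj (dp_word p).
Proof. by apply: maj_map_eq => i j _ _; apply: std_letter_lt. Qed.

(** The signs in the standardization give the set of signed fixed points, and
    this set in turn determines the renumbering, which can then be undone. *)
Lemma std_word_inj (n : nat) : injective (@std_word n).
Proof.
move=> p p' eq_pp'.
have eq_std i : std_letter p i = std_letter p' i.
  by have/eq_in_map := eq_pp'; apply; rewrite mem_enum.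
have eqS : dp_signed p = dp_signed p'.
  apply/setP => i; have := eq_std i; rewrite /std_letter.
  by do 2!case: ifP => //; lia.
apply: decperm_eq => //; apply/permP => i.
have [Si|S'i] := boolP (i \in dp_signed p).
  by rewrite !dp_signed_fix // -eqS.
have := eq_std i; rewrite /std_letter -eqS (negPf S'i) => -[].
apply: (index_inj i); rewrite mem_enum inE; first by rewrite dp_perm_signed.
by rewrite eqS dp_perm_signed -eqS.
Qed.

Lemma map_index_uniq (T : eqType) (s : seq T) :
  uniq s -> [seq index x s | x <- s] = iota 0 (size s).
Proof.
case: s => // x0 s; set t := x0 :: s => uniq_t.
apply: (@eq_from_nth _ 0%N) => [|i]; rewrite size_map ?size_iota // => lt_it.
by rewrite (nth_map x0) // nth_iota // index_uniq.
Qed.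

Lemma std_word_shuffle (n k : nat) (p : decperm n) :
  #|dp_signed p| = k -> std_word p \in shuffles (n - k) k.
Proof.
move=> card_S; rewrite -card_S; set S := dp_signed p.
have filter_enum (a : pred int) (B : {set 'I_n}) :
    (forall i, a (std_letter p i) = (i \in B)) ->
    [seq x <- std_word p | a x] = [seq std_letter p i | i <- enum B].
  move=> aB; rewrite filter_map (eq_filter (a2 := mem B)) => [|i /=]; last exact: aB.
  by rewrite enumT.
apply: mem_shuffles.
- rewrite (filter_enum _ S) => [|i]; last by rewrite /std_letter -/S; case: ifP; lia.
  rewrite /neg_word cardE -map_index_uniq ?enum_uniq // -map_comp.
  by apply/eq_in_map => i; rewrite mem_enum /std_letter -/S /= => ->.
(* The unsigned letters, read as a word, permute the complement of [S]. *)
- rewrite (filter_enum _ (~: S)) => [|i]; last first.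
    by rewrite inE /std_letter -/S; case: ifP; lia.
  have -> : (n - #|S|)%N = #|~: S| by rewrite [RHS]cardsCs setCK card_ord.
  rewrite cardE -map_index_uniq ?enum_uniq // -map_comp.
  have -> : [seq std_letter p i | i <- enum (~: S)] =
            [seq (index i (enum (~: S))).+1%:Z | i <- map (dp_perm p) (enum (~: S))].
    rewrite -map_comp; apply/eq_in_map => i.
    by rewrite mem_enum inE /std_letter -/S /= => /negPf->.
  apply/perm_map/uniq_perm; rewrite ?(map_inj_uniq perm_inj) ?enum_uniq // => i.
  rewrite mem_enum inE -[i](permKV (dp_perm p)) (mem_map perm_inj) mem_enum inE.
  by rewrite dp_perm_signed.
Qed.

(** Such decorated permutations are the permutations supported off [S]. *)
Lemma card_decperm_signed (n : nat) (S : {set 'I_n}) :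
  #|[set p : decperm n | dp_signed p == S]| = (n - #|S|)`!.
Proof.
have -> : (n - #|S|)%N = #|~: S| by rewrite [RHS]cardsCs setCK card_ord.
rewrite -card_perm.
rewrite -(card_in_imset (f := @dp_perm n)); last first.
  move=> p p'; rewrite !inE => /eqP pS /eqP p'S eq_perm.
  by apply: decperm_eq => //; rewrite pS p'S.
apply: eq_card => s; apply/imsetP/idP => [[p]|].
  rewrite inE => /eqP <- ->; apply/subsetP => i.
  by rewrite !inE; apply: contraNN => /dp_signed_fix->.
move=> /subsetP s_on.
have fixS : (s, S).2 \subset [set i | (s, S).1 i == i].
  apply/subsetP => i /= Si; rewrite inE; apply/negPn/negP => /s_on.
  by rewrite inE Si.
by exists (DecPerm fixS); rewrite ?inE.
Qed.

Lemma card_signed_decperms (n k : nat) :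
  (#|signed_decperms n k| = 'C(n, k) * (n - k)`!)%N.
Proof.
rewrite -sum1_card (partition_big (@dp_signed n) (fun S => #|S| == k)) /=; last first.
  by move=> p; rewrite inE.
rewrite (eq_bigr (fun=> (n - k)`!)) => [|S /eqP card_S].
  by rewrite sum_nat_const -[X in 'C(X, _)]card_ord -card_draws cardsE.
rewrite -[in RHS]card_S -card_decperm_signed -sum1_card; apply: eq_bigl => p.
by rewrite !inE; case: (dp_signed p =P S) => [->|]; rewrite ?card_S ?eqxx ?andbF.
Qed.

(** Each factor is a polynomial in q with constant term 1. *)
Lemma qfact_qvar_neq0 (k : nat) : qfact qvar k != 0.
Proof.
rewrite /qfact prodf_seq_neq0; apply/allP => i; rewrite mem_index_iota /=.
case: i => // i _; rewrite /qint.
under eq_bigr => j _ do rewrite /qvar -tofracXn.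
rewrite -raddf_sum /= tofrac_eq0; apply/negP => /eqP/(congr1 (fun r : {poly int} => r`_0)).
rewrite coef0 coef_sum big_nat_recl //= expr0 coef1 /= big1 ?addr0 // => j _.
by rewrite coefXn.
Qed.

Theorem theorem1p4 (n k : nat) (n_gt0 : (0 < n)%N) (le_kn : (k <= n)%N) :
  \sum_(p in signed_decperms n k) qvar ^+ maj (dp_word p) =
  qvar ^+ 'C(k, 2) * (qfact qvar n / qfact qvar k).
Proof.
(* Standardization is injective into a list that is no longer than E_{n,k}, so
   it reaches the whole list, which is moreover free of repetitions. *)
have perm_std :
    perm_eq [seq std_word p | p <- enum (signed_decperms n k)] (shuffles (n - k) k).
  have uniq_std : uniq [seq std_word p | p <- enum (signed_decperms n k)].
    by rewrite (map_inj_uniq (@std_word_inj n)) enum_uniq.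
  have sub_std : {subset [seq std_word p | p <- enum (signed_decperms n k)]
                    <= shuffles (n - k) k}.
    move=> _ /mapP[p + ->]; rewrite mem_enum inE => /eqP.
    exact: std_word_shuffle.
  have size_std : (size (shuffles (n - k) k) <=
      size [seq std_word p | p <- enum (signed_decperms n k)])%N.
    rewrite size_map -cardE card_signed_decperms -(leq_pmul2r (fact_gt0 k)).
    by rewrite size_shuffles subnK // -mulnA [(_ `! * _)%N]mulnC bin_fact.
  have [size_eq mem_eq] := uniq_min_size uniq_std sub_std size_std.
  by apply: uniq_perm => //; rewrite -(eq_uniq size_eq mem_eq).
under eq_bigr => p _ do rewrite -maj_std_word.
rewrite -big_enum /= -(big_map _ xpredT (fun w => qvar ^+ maj w)).
rewrite (perm_big _ perm_std) /= sum_maj_shuffles subnK //; congr (_ * _).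
apply: (canRL (mulfK (qfact_qvar_neq0 k))).
by rewrite mulrC /qfact -big_cat_nat.
Qed.
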